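(* Let $X$ be a locally compact space. Then $$\mu\big(\mathcal T_K(X)\big)=\mathcal B(X^* )\setminus\{\emptyset\}.$$
   Context: Locally compact spaces and compact spaces are assumed Hausdorff. For a Tychonoff space $X$, a one-point extension of $X$ is a Tychonoff space $Y$ containing $X$ as a dense subspace such that $Y\setminus X$ is a singleton; we write $Y=X\cup\{p\}$. Two extensions are identified if there is a homeomorphism between them fixing $X$ pointwise. $\mathcal T(X)$ is the set of all (equivalence classes of) one-point extensions of $X$, and $\mathcal T_K(X)=\{Y\in\mathcal T(X): Y\text{ is locally compact}\}$. $\beta X$ is the Stone-Čech compactification of $X$ and $X^*=\beta X\setminus X$. $\mathcal B(T)$ is the set of all clopen (open and closed) subsets of a space $T$. For $Y=X\cup\{p\}\in\mathcal T(X)$, $F_Y:\beta X\to\beta Y$ is the unique continuous function with $F_Y|X=\mathrm{id}_X$, and $\mu(Y)=F_Y^{-1}(p)$, a non-empty closed subset of $X^*$. *)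

(* Defs.v *)
From HB Require Import structures.
From mathcomp Require Import all_boot all_order all_algebra.
From mathcomp Require Import all_classical all_reals all_analysis.
Import numFieldNormedType.Exports.

Set Implicit Arguments.
Unset Strict Implicit.
Unset Printing Implicit Defensive.

Import Order.TTheory GRing.Theory Num.Theory.
Local Open Scope classical_set_scope.
Local Open Scope ring_scope.

(* By [uniform_separatorP], [completely_regular_space] is the separation of
   points from closed sets by continuous functions into [0, 1]. *)
Definition tychonoff_space (X : topologicalType) : Prop :=
  hausdorff_space X /\ completely_regular_space X.

Definition topological_embedding (X Y : topologicalType) (f : X -> Y) : Prop :=
  injective f /\
  forall U : set X, open U <-> exists2 V : set Y, open V & f @^-1` V = U.

Definition unit_interval (R : realType) : topologicalType :=
  (`[0 : R, 1]%classic : set R).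

Definition cube (R : realType) (X : topologicalType) : topologicalType :=
  prod_topology (fun _ : continuousType X (unit_interval R) => unit_interval R).

Definition cube_eval (R : realType) (X : topologicalType) (x : X) : cube R X :=
  fun f => f x.
Arguments cube_eval R {X} x.

(* The carrier is a subtype with the subspace topology. For X not Tychonoff
   this is still a compact Hausdorff space, but X does not embed into it. *)
Definition stone_cech (R : realType) (X : topologicalType) : topologicalType :=
  closure (range (@cube_eval R X)).

Lemma cube_eval_closure (R : realType) (X : topologicalType) (x : X) :
  cube_eval R x \in closure (range (@cube_eval R X)).
Proof. by apply/mem_set/subset_closure; exists x. Qed.

Definition stone_cech_eta (R : realType) (X : topologicalType) (x : X) :
  stone_cech R X := exist _ (cube_eval R x) (cube_eval_closure R x).
Arguments stone_cech_eta R {X} x.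

Lemma cube_proj_continuous (R : realType) (X : topologicalType)
    (f : continuousType X (unit_interval R)) :
  continuous (fun z : cube R X => z f).
Proof. exact: (@proj_continuous _ (fun=> unit_interval R)). Qed.

Lemma cube_continuous (R : realType) (X S : topologicalType) (g : S -> cube R X) :
  (forall f, continuous (fun s => g s f)) -> continuous g.
Proof.
move=> cg s; apply/cvg_sup => f U [_ [[V oV <-] Vs] VU].
apply: (filterS VU); rewrite nbhs_simpl; apply: (cg f s).
by apply: open_nbhs_nbhs; split.
Qed.

Lemma subtype_continuous (S T : topologicalType) (A : set T) (g : S -> A) :
  continuous (fun s => set_val (g s)) -> continuous g.
Proof.
move=> cg s U [_ [[V oV <-] Vs] VU].
apply: (filterS VU); rewrite nbhs_simpl; apply: (cg s).
by apply: open_nbhs_nbhs; split.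
Qed.

Lemma subtype_val_continuous (T : topologicalType) (A : set T) :
  continuous (set_val : A -> T).
Proof. exact: initial_continuous. Qed.

Definition cube_map (R : realType) (X Y : topologicalType)
    (f : continuousType X Y) (z : cube R X) : cube R Y := fun g => z (g \o f).

Lemma cube_map_continuous (R : realType) (X Y : topologicalType)
    (f : continuousType X Y) : continuous (@cube_map R X Y f).
Proof. by apply: cube_continuous => g; exact: cube_proj_continuous. Qed.

Lemma cube_map_closure (R : realType) (X Y : topologicalType)
    (f : continuousType X Y) (z : stone_cech R X) :
  cube_map f (set_val z) \in closure (range (@cube_eval R Y)).
Proof.
have clz := set_mem (valP z); apply/mem_set => U Uz.
have [_ [[x _ <-] Ux]] := clz _ (cube_map_continuous (f := f) Uz).
by exists (cube_eval R (f x)); split => //; exists (f x).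
Qed.

Definition stone_cech_map (R : realType) (X Y : topologicalType)
    (f : continuousType X Y) (z : stone_cech R X) : stone_cech R Y :=
  exist _ (cube_map f (set_val z)) (cube_map_closure f z).

Lemma injective_hausdorff (S T : topologicalType) (f : S -> T) :
  injective f -> continuous f -> hausdorff_space T -> hausdorff_space S.
Proof.
move=> fI cf; rewrite !open_hausdorff => hT x y xy.
have /hT[[A B] /= [Ax By] [oA oB AB]] : f x != f y.
  by apply: contra_neq xy => /fI.
exists (f @^-1` A, f @^-1` B) => /=.
  by split; apply/mem_set; [exact: (set_mem Ax)|exact: (set_mem By)].
split; try by apply: open_comp => // z _; exact: cf.
by rewrite -preimage_setI (eqP AB) preimage_set0.
Qed.

Lemma compact_subtype (T : topologicalType) (A : set T) :
  compact A -> compact [set: A].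
Proof.
move=> cA F PF _.
have [x [Ax cx]] : A `&` cluster (set_val @ F) !=set0.
  apply: cA; rewrite nbhs_simpl /=.
  by apply: (@filterS _ F _ setT) filterT => z _; exact: set_valP.
exists (exist _ x (mem_set Ax)); split => // B U FB [_ [[V oV <-] Vx] VU].
have FB' : (set_val @ F) (set_val @` B).
  by apply: (@filterS _ F _ B) FB => z Bz; exists z.
have [y [[z Bz <-] Vz]] := cx _ V FB' (open_nbhs_nbhs (conj oV Vx)).
by exists z; split => //; exact: VU.
Qed.

Lemma dense_continuous_eq (S T : topologicalType) (D : set S) (f g : S -> T) :
  hausdorff_space T -> dense D -> continuous f -> continuous g ->
  {in D, f =1 g} -> f =1 g.
Proof.
rewrite open_hausdorff => hT dD cf cg fg s; apply: contrapT => /eqP /hT.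
move=> [[A B] /= [/set_mem As /set_mem Bs] [oA oB AB]].
have oAB : open (f @^-1` A `&` g @^-1` B).
  apply: openI; first by apply: open_comp => // z _; exact: cf.
  by apply: open_comp => // z _; exact: cg.
have [t [[At Bt] Dt]] := dD _ (ex_intro _ s (conj As Bs)) oAB.
have : (A `&` B) (f t) by split => //; rewrite fg //; exact/mem_set.
by rewrite (eqP AB).
Qed.

Lemma tychonoff_separation (R : realType) (X : topologicalType) (x : X) (B : set X) :
  tychonoff_space X -> closed B -> ~ B x ->
  exists f : continuousType X (unit_interval R),
    val (f x) = 0 /\ forall y, B y -> val (f y) = 1.
Proof.
move=> [_ crX] cB Bx; have /(uniform_separatorP (R := R)) := crX x B cB Bx.
move=> [f [cf fI f0 f1]].
have fP y : f y \in (`[0, 1]%classic : set R) by apply/mem_set/fI; exists y.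
pose g y : unit_interval R := exist _ (f y) (fP y).
have cg : continuous g by apply: subtype_continuous; exact: cf.
pose G : X -> unit_interval R := mkcts cg.
exists G; split => [|y By]; first by apply: f0; exists x.
by apply: f1; exists y.
Qed.

Lemma stone_cech_hausdorff (R : realType) (X : topologicalType) :
  hausdorff_space (stone_cech R X).
Proof.
apply: (@injective_hausdorff _ (cube R X) set_val).
- exact: val_inj.
- exact: subtype_val_continuous.
- apply: (@hausdorff_product _ (fun=> unit_interval R)) => _.
  apply: (@injective_hausdorff _ R set_val); first exact: val_inj.
    exact: subtype_val_continuous.
  exact: Rhausdorff.
Qed.

Lemma stone_cech_compact (R : realType) (X : topologicalType) :
  compact [set: stone_cech R X].
Proof.
apply: compact_subtype; apply: (@subclosed_compact _ _ [set: cube R X]) => //.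
  exact: closed_closure.
have := @tychonoff _ (fun=> unit_interval R) (fun=> setT)
  (fun _ : continuousType X (unit_interval R) =>
     compact_subtype (@segment_compact R 0 1)).
by congr compact; apply/seteqP; split.
Qed.

Lemma stone_cech_eta_continuous (R : realType) (X : topologicalType) :
  continuous (@stone_cech_eta R X).
Proof.
apply: subtype_continuous; apply: cube_continuous => f; exact: cts_fun.
Qed.

Lemma stone_cech_eta_dense (R : realType) (X : topologicalType) :
  dense (range (@stone_cech_eta R X)).
Proof.
move=> O [z Oz] [V oV VO].
have Vz : V (set_val z) by rewrite -VO in Oz.
have [_ [[x _ <-] Vx]] := set_mem (valP z) _ (open_nbhs_nbhs (conj oV Vz)).
by exists (stone_cech_eta R x); split; [rewrite -VO | exists x].
Qed.

Lemma stone_cech_eta_embedding (R : realType) (X : topologicalType) :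
  tychonoff_space X -> topological_embedding (@stone_cech_eta R X).
Proof.
move=> tX; split=> [x y xy|U].
  apply: contrapT => nxy.
  have cy : closed [set y].
    exact/accessible_closed_set1/hausdorff_accessible/(proj1 tX).
  have [f [f0 f1]] := @tychonoff_separation R X _ _ tX cy nxy.
  have fxy : f x = f y by exact: (congr1 (fun z => set_val z f) xy).
  by move/eqP: (f1 y erefl); rewrite -fxy f0 eq_sym oner_eq0.
split=> [oU|[V oV <-]]; last first.
  by apply: open_comp => // x _; exact: stone_cech_eta_continuous.
pose D := [set f : continuousType X (unit_interval R) |
  forall y, (~` U) y -> val (f y) = 1].
pose W := \bigcup_(f in D) [set z : cube R X | val (z f) < 1].
exists (set_val @^-1` W).
  apply: open_comp; first by move=> z _; exact: subtype_val_continuous.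
  apply: bigcup_open => f _.
  apply: (@open_comp _ _ (fun z : cube R X => val (z f)) [set r : R | r < 1]).
    move=> z _; apply: (@continuous_comp _ _ _ (fun z : cube R X => z f) val).
      exact: cube_proj_continuous.
    exact: subtype_val_continuous.
  exact: open_lt.
apply/seteqP; split=> [x [f Df /= fx]|x Ux].
  by apply: contrapT => /Df fx1; move: fx; rewrite /cube_eval fx1 ltxx.
have [//||f [f0 f1]] := @tychonoff_separation R X x (~` U) tX.
- exact: open_closedC.
- by apply.
- by exists f => //=; rewrite /cube_eval f0 ltr01.
Qed.

Lemma stone_cech_map_continuous (R : realType) (X Y : topologicalType)
    (f : continuousType X Y) : continuous (@stone_cech_map R X Y f).
Proof.
apply: subtype_continuous => z.
apply: (@continuous_comp _ _ _ set_val (cube_map f)).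
  exact: subtype_val_continuous.
exact: cube_map_continuous.
Qed.

Lemma stone_cech_mapE (R : realType) (X Y : topologicalType)
    (f : continuousType X Y) (x : X) :
  stone_cech_map f (stone_cech_eta R x) = stone_cech_eta R (f x).
Proof. exact: val_inj. Qed.

Lemma stone_cech_map_unique (R : realType) (X Y : topologicalType)
    (f : continuousType X Y) (F : stone_cech R X -> stone_cech R Y) :
  continuous F -> (forall x, F (stone_cech_eta R x) = stone_cech_eta R (f x)) ->
  F = stone_cech_map f.
Proof.
move=> cF FE; apply/funext.
apply: (dense_continuous_eq (@stone_cech_hausdorff R Y)
  (@stone_cech_eta_dense R X) cF (@stone_cech_map_continuous R X Y f)).
by move=> _ /set_mem [x _ <-]; rewrite FE stone_cech_mapE.
Qed.

Lemma stone_cech_universal (R : realType) (X K : topologicalType)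
    (f : continuousType X K) :
  hausdorff_space K -> compact [set: K] ->
  exists! F : stone_cech R X -> K,
    continuous F /\ (forall x, F (stone_cech_eta R x) = f x).
Proof.
move=> hK cK.
have tK : tychonoff_space K.
  split=> //; apply: (normal_completely_regular (R := R)).
    exact: compact_normal.
  exact: hausdorff_accessible.
have [etaI etaO] := @stone_cech_eta_embedding R K tK.
have eta_surj (z : stone_cech R K) : exists y, stone_cech_eta R y = z.
  have cl : closed (range (@stone_cech_eta R K)).
    apply: compact_closed; first exact: stone_cech_hausdorff.
    apply: continuous_compact => //; apply: continuous_subspaceT.
    exact: stone_cech_eta_continuous.
  apply: contrapT => nz.
  have nz' : (~` range (@stone_cech_eta R K)) z.
    by move=> [y _ yz]; apply: nz; exists y.
  by have [t [nt /nt]] := stone_cech_eta_dense (ex_intro _ z nz') (closed_openC cl).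
pose r z := projT1 (cid (eta_surj z)).
have rK z : stone_cech_eta R (r z) = z := projT2 (cid (eta_surj z)).
have cr : continuous r.
  apply/continuousP => U /etaO [V oV <-].
  rewrite (_ : _ @^-1` _ = V) //; apply/seteqP.
  by split=> z /=; rewrite rK.
exists (r \o stone_cech_map f); split.
  split=> [z|x].
    by apply: continuous_comp; [exact: stone_cech_map_continuous|exact: cr].
  by apply: etaI; rewrite /= rK stone_cech_mapE.
move=> G [cG GE]; apply/funext.
apply: (dense_continuous_eq hK (@stone_cech_eta_dense R X)) => //.
  move=> z; apply: continuous_comp; last exact: cr.
  exact: stone_cech_map_continuous.
move=> _ /set_mem [x _ <-]; rewrite GE.
by apply: etaI; rewrite /= rK stone_cech_mapE.
Qed.

Definition stone_cech_remainder (R : realType) (X : topologicalType) :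
    topologicalType :=
  (~` range (@stone_cech_eta R X)).

(* Representatives, on arbitrary carriers, of the one-point extensions of X:
   [ope_incl] plays the role of the inclusion of X into X U {p}. *)
Record one_point_extension (X : topologicalType) := OnePointExtension {
  ope_space :> topologicalType;
  ope_incl : continuousType X ope_space;
  ope_pt : ope_space;
  ope_tychonoff : tychonoff_space ope_space;
  ope_embedding : topological_embedding ope_incl;
  ope_dense : dense (range ope_incl);
  ope_remainder : ~` range ope_incl = [set ope_pt]
}.

(* [ope_equiv_mu] and [ope_equiv_locally_compact] below show that [ope_mu] and
   local compactness only depend on the class of an extension. *)
Definition ope_equiv (X : topologicalType) (Y Z : one_point_extension X) :=
  exists (h : continuousType Y Z) (k : continuousType Z Y),
    [/\ cancel h k, cancel k h & forall x, h (ope_incl Y x) = ope_incl Z x].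

(* By [stone_cech_mapE] and [stone_cech_map_unique], [stone_cech_map] of the
   inclusion is the unique continuous map of beta X into beta Y that is the
   identity on X. *)
Definition ope_mu (R : realType) (X : topologicalType)
    (Y : one_point_extension X) : set (stone_cech R X) :=
  stone_cech_map (ope_incl Y) @^-1` [set stone_cech_eta R (ope_pt Y)].
Arguments ope_mu R {X} Y.

(* The image under [ope_mu] of the extensions satisfying P. It is the unfolding
   of [image]: [one_point_extension X] lives in a universe that is too large
   for [set (one_point_extension X)]. Passing to [ope_equiv] classes first
   yields the same set, by [ope_equiv_mu]. *)
Definition ope_mu_image (R : realType) (X : topologicalType)
    (P : one_point_extension X -> Prop) : set (set (stone_cech R X)) :=
  [set A | exists2 Y : one_point_extension X, P Y & ope_mu R Y = A].
Arguments ope_mu_image R {X} P.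

Lemma ope_equiv_pt (X : topologicalType) (Y Z : one_point_extension X)
    (h : Y -> Z) (k : Z -> Y) :
  cancel h k -> cancel k h -> (forall x, h (ope_incl Y x) = ope_incl Z x) ->
  h (ope_pt Y) = ope_pt Z.
Proof.
move=> hK kK hE.
have : [set ope_pt Y] (ope_pt Y) by [].
rewrite -(ope_remainder Y) => nY.
suff : (~` range (ope_incl Z)) (h (ope_pt Y)) by rewrite ope_remainder.
by move=> [x _ xE]; apply: nY; exists x => //; rewrite -[RHS]hK -xE -hE hK.
Qed.

Lemma ope_equiv_sym (X : topologicalType) (Y Z : one_point_extension X) :
  ope_equiv Y Z -> ope_equiv Z Y.
Proof.
move=> [h [k [hK kK hE]]]; exists k, h; split=> // x.
by rewrite -hE hK.
Qed.

Lemma ope_equiv_mu (R : realType) (X : topologicalType)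
    (Y Z : one_point_extension X) :
  ope_equiv Y Z -> ope_mu R Y = ope_mu R Z.
Proof.
suff sub (Y' Z' : one_point_extension X) :
    ope_equiv Y' Z' -> ope_mu R Y' `<=` ope_mu R Z'.
  by move=> YZ; apply/seteqP; split; apply: sub => //; exact: ope_equiv_sym.
move=> [h [k [hK kK hE]]] z; rewrite /ope_mu /= => zE.
rewrite -(ope_equiv_pt hK kK hE) -stone_cech_mapE -zE.
have -> // : stone_cech_map (ope_incl Z') =
    stone_cech_map h \o @stone_cech_map R _ _ (ope_incl Y').
apply/esym/stone_cech_map_unique => [t|x]; last by rewrite /= !stone_cech_mapE hE.
by apply: continuous_comp; exact: stone_cech_map_continuous.
Qed.

Lemma ope_equiv_locally_compact (X : topologicalType)
    (Y Z : one_point_extension X) :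
  ope_equiv Y Z -> locally_compact [set: Y] -> locally_compact [set: Z].
Proof.
move=> [h [k [hK kK hE]]] lY z _.
have [U Uk [cU clU]] := lY (k z) I.
exists (k @^-1` U).
  have Uk' : nbhs (k z) U by rewrite -[nbhs (k z)]withinET.
  by rewrite withinET; exact: (@cts_fun _ _ k z U Uk').
split; last by apply: preimage_closed => // y _; exact: cts_fun.
rewrite (_ : _ @^-1` _ = h @` U).
  by apply: continuous_compact => //; apply: continuous_subspaceT => y; exact: cts_fun.
apply/seteqP; split=> [y Uy|_ [y Uy <-]]; first by exists (k y).
by rewrite /= hK.
Qed.

(* Main.v *)
Require Import Defs.
From mathcomp Require Import all_boot all_order all_algebra.
From mathcomp Require Import all_classical all_reals all_analysis.
Local Open Scope classical_set_scope.

Set Implicit Arguments.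
Unset Strict Implicit.
Unset Printing Implicit Defensive.

(** Write [beta X] for the Stone-Cech compactification and
    [F : beta X -> beta Y] for the extension of the inclusion of [X] into a
    one-point extension [Y] with extra point [p].

    Everything rests on the density argument of [locally_compact_lift]. Let [e]
    be a continuous map of a locally compact space onto a dense subspace of a
    Hausdorff space [S], and let [F] be continuous on [S] with [F \o e] an
    embedding. Then the points of [S] outside the range of [e] stay away under
    [F] from the image of [F \o e], because compact neighborhoods of [X] are
    already closed in [S]. With [F] the identity it says that [X] is open in
    [beta X], so that the remainder is closed.

    If [Y] is locally compact, the argument applied to [F] shows that a point
    of the remainder of [X] can be sent into [Y] only by being sent to [p].
    Hence the fiber of [p] is the trace on the remainder of the preimage of
    [Y], which is open in [beta Y], and so it is clopen in the remainder
    ([ope_mu_locally_compact]); it is nonempty since [F] is onto.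

    Conversely a clopen subset [A] of the remainder is closed in [beta X], and
    collapsing [A] to a point gives a compact Hausdorff space, realized as the
    one-point compactification of the complement of [A]. The union of [X] and
    [A] is open in [beta X] because [A] is open in the remainder; its image is
    therefore open in a compact Hausdorff space, and is a locally compact
    one-point extension [Y] of [X] ([collapse_extension]). The collapsing map
    factors through [F], and the density argument, used this time for [Y],
    identifies the fiber of [p] with [A] ([ope_mu_collapse]). *)

(** * Embeddings, subspaces and local compactness *)

Lemma hausdorff_locally_compact (T : topologicalType) :
  hausdorff_space T -> (forall x : T, exists2 C, nbhs x C & compact C) ->
  locally_compact [set: T].
Proof.
move=> hT cT x _; have [C Cx cC] := cT x; exists C; first by rewrite withinET.
by split=> //; exact: compact_closed.
Qed.

Lemma locally_compact_tychonoff (R : realType) (T : topologicalType) :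
  hausdorff_space T -> locally_compact [set: T] -> tychonoff_space T.
Proof.
by move=> hT lT; split=> //; exact: (@locally_compact_completely_regular _ R).
Qed.

Lemma topological_embedding_continuous (X Y : topologicalType) (f : X -> Y) :
  topological_embedding f -> continuous f.
Proof. by move=> [_ fO]; apply/continuousP => V oV; apply/fO; exists V. Qed.

Lemma topological_embedding_comp (X Y Z : topologicalType) (f : X -> Y) (g : Y -> Z) :
  topological_embedding f -> topological_embedding g ->
  topological_embedding (g \o f).
Proof.
move=> [fI fO] [gI gO]; split; first exact: inj_comp.
move=> U; split=> [/fO[V /gO[W oW <-] <-]|[W oW <-]]; first by exists W.
by apply/fO; exists (g @^-1` W) => //; apply/gO; exists W.
Qed.

Lemma set_val_embedding (T : topologicalType) (A : set T) :
  topological_embedding (set_val : A -> T).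
Proof. by split; first exact: val_inj. Qed.

Lemma subtype_hausdorff (T : topologicalType) (A : set T) :
  hausdorff_space T -> hausdorff_space A.
Proof.
apply: (@injective_hausdorff A T set_val); first exact: val_inj.
exact: subtype_val_continuous.
Qed.

Lemma image_preimage_set_val (T : Type) (A V : set T) :
  set_val @` (set_val @^-1` V : set A) = A `&` V.
Proof.
apply/seteqP; split=> [_ [z Vz <-]|z [Az Vz]]; first by split=> //; exact: set_valP.
by exists (exist _ z (mem_set Az)).
Qed.

(** Closedness and openness in the remainder refer to the subtype topology; this
    carries closed subsets back to the ambient space. *)
Lemma closed_subtype_image (T : topologicalType) (A : set T) (B : set A) :
  closed A -> closed B -> closed (set_val @` B).
Proof.
move=> clA /closed_openC[V oV VB].
have -> : B = set_val @^-1` (~` V) by rewrite -[B]setCK -VB.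
rewrite image_preimage_set_val; apply: closedI => //; exact: open_closedC.
Qed.

Lemma topological_embedding_compact (S T : topologicalType) (f : S -> T) (C : set S) :
  topological_embedding f -> compact (f @` C) -> compact C.
Proof.
move=> [_ fO] cC F PF FC.
have [_ [[x Cx <-] cx]] : f @` C `&` cluster (f @ F) !=set0.
  apply: cC; apply: (@filterS _ F _ C) FC => z Cz.
    by exists z.
exists x; split=> // B U FB.
rewrite nbhsE => -[W [oW Wx] WU]; have [V oV VW] := proj1 (fO W) oW.
have FB' : (f @ F) (f @` B) by apply: (@filterS _ F _ B) FB => z Bz; exists z.
have Vx : V (f x) by rewrite -VW in Wx.
have [y [[z Bz <-] Vz]] := cx _ V FB' (open_nbhs_nbhs (conj oV Vx)).
by exists z; split=> //; apply: WU; rewrite -VW.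
Qed.

Lemma dense_range_comp (X Y Z : topologicalType) (f : X -> Y) (g : Y -> Z) :
  continuous g -> dense (range f) -> dense (range g) -> dense (range (g \o f)).
Proof.
move=> cg df dg O O0 oO.
have [u [Oy [y _ yE]]] := dg O O0 oO.
have oO' : open (g @^-1` O) by apply: open_comp => // z _; exact: cg.
have [|v [Ox [x _ xE]]] := df _ _ oO'; first by exists y; rewrite /= yE.
by exists (g (f x)); split; [rewrite xE|exists x].
Qed.

Lemma compact_dense_surjective (S T : topologicalType) (f : S -> T) :
  compact [set: S] -> hausdorff_space T -> continuous f -> dense (range f) ->
  forall t, exists s, f s = t.
Proof.
move=> cS hT cf df t; apply: contrapT => nt.
have cl : closed (range f).
  apply: compact_closed => //; apply: continuous_compact => //.
  exact: continuous_subspaceT.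
have nt' : (~` range f) t by move=> [s _ st]; apply: nt; exists s.
by have [u [nu /nu]] := df _ (ex_intro _ t nt') (closed_openC cl).
Qed.

(** * Dense images of locally compact spaces *)

(** Take a compact neighborhood [K] of [x] and [V] open whose preimage in [X] is
    an open neighborhood of [x] inside [K]. By density every point of
    [F @^-1` V] is in the closure of [e @` K], which is compact, hence closed. *)
Lemma locally_compact_lift (X S T : topologicalType)
    (e : X -> S) (F : S -> T) (x : X) :
  locally_compact [set: X] -> hausdorff_space S -> continuous e -> continuous F ->
  dense (range e) -> topological_embedding (F \o e) ->
  exists2 V, open V /\ V (F (e x)) & F @^-1` V `<=` range e.
Proof.
move=> lX hS ce cF de [_ FeO].
have [K] := lX x I; rewrite withinET nbhsE => -[U [oU Ux] UK] [cK _].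
move: (oU) => /FeO[V oV VU]; exists V; first by split=> //; rewrite -VU in Ux.
move=> z Vz.
suff : (e @` K) z by move=> [y _ <-]; exists y.
have cl : closed (e @` K).
  apply: compact_closed => //; apply: continuous_compact => //.
  exact: continuous_subspaceT.
apply: cl => N; rewrite nbhsE => -[W [oW Wz] WN].
have oFV : open (W `&` F @^-1` V).
  by apply: openI => //; apply: open_comp => // s _; exact: cF.
have [u [[Wy Vy] [y _ yE]]] := de _ (ex_intro _ z (conj Wz Vz)) oFV.
exists (e y); split; last by apply: WN; rewrite yE.
by exists y => //; apply: UK; rewrite -VU /= yE.
Qed.

(** The form in which the density argument is used: no point of [S] other than
    [e x] can be glued by [F] to the image of [x]. *)
Lemma locally_compact_lift_fiber (X S T : topologicalType)
    (e : X -> S) (F : S -> T) (x : X) (z : S) :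
  locally_compact [set: X] -> hausdorff_space S -> continuous e -> continuous F ->
  dense (range e) -> topological_embedding (F \o e) ->
  F z = F (e x) -> z = e x.
Proof.
move=> lX hS ce cF de emb zx.
have [V [_ Vx] VE] := @locally_compact_lift _ _ _ _ _ x lX hS ce cF de emb.
have [|y _ yz] := VE z; first by rewrite /= zx.
by rewrite -yz; congr e; apply: (proj1 emb); rewrite /= yz.
Qed.

Lemma locally_compact_dense_open (X T : topologicalType) (e : X -> T) :
  locally_compact [set: X] -> hausdorff_space T -> topological_embedding e ->
  dense (range e) -> open (range e).
Proof.
move=> lX hT emb de; rewrite openE => _ [x _ <-].
have [||V [oV Vx] VE] := @locally_compact_lift _ _ _ e id x lX hT _ _ de emb.
- exact: topological_embedding_continuous.
- by move=> z; exact: cvg_id.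
by rewrite /interior nbhsE; exists V.
Qed.

(** Regularity of [T] shrinks [A] to a closed neighborhood contained in [A], and
    such a neighborhood stays compact in the topology of the subtype. *)
Lemma compact_open_locally_compact (T : topologicalType) (A : set T) :
  compact [set: T] -> hausdorff_space T -> open A -> locally_compact [set: A].
Proof.
move=> cT hT oA.
have hA : hausdorff_space A.
  exact: subtype_hausdorff.
apply: hausdorff_locally_compact => // x.
have nA : nbhs (set_val x) A.
  by apply: open_nbhs_nbhs; split=> //; exact: set_valP.
have [C Cx CA] := @compact_regular _ (set_val x) _ hT cT filterT A nA.
exists (set_val @^-1` closure C).
  apply: (@subtype_val_continuous _ A x).
  by apply: filterS Cx; exact: subset_closure.
apply: (topological_embedding_compact (@set_val_embedding _ A)).
apply: (@subclosed_compact _ _ [set: T]) => //.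
rewrite (_ : _ @` _ = closure C); first exact: closed_closure.
apply/seteqP; split=> [_ [y Cy <-] //|y Cy].
by exists (exist _ y (mem_set (CA _ Cy))).
Qed.

(** * Collapsing a closed subset of a compact space *)

(** Local compactness is what separates a point of [T] from infinity: a compact
    neighborhood is disjoint from the neighborhood of infinity that it defines. *)
Lemma one_point_compactification_hausdorff (T : topologicalType) :
  hausdorff_space T -> locally_compact [set: T] ->
  hausdorff_space (one_point_compactification T).
Proof.
move=> hT lT.
have sep (x : T) : ~ cluster (nbhs (Some x : one_point_compactification T)) None.
  have [C] := lT x I; rewrite withinET => Cx [cC clC] /(_ (Some @` C)).
  have nN : nbhs (None : one_point_compactification T)
      (Some @` (~` C) `|` [set None]) by exists C.
  move=> /(_ _ (one_point_compactification_some_nbhs _ _ Cx) nN).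
  by move=> [_ [[y Cy <-] [[z nCz [zy]]|//]]]; apply: nCz; rewrite zy.
move=> [x|] [y|] // xy; last 2 first.
- by case: (sep x).
- case: (sep y) => A B nA nB.
  by have [z []] := xy _ _ nB nA; exists z.
congr Some; apply: hT => A B nA nB.
have [_ [[a Aa <-] [b Bb [ba]]]] := xy _ _
  (one_point_compactification_some_nbhs _ _ nA)
  (one_point_compactification_some_nbhs _ _ nB).
by exists a; split=> //; rewrite -ba.
Qed.

(** The quotient map of [K] identifying [A] to a point, with [None] for the
    class of [A]. Realizing the quotient as a one-point compactification makes
    its compactness and separation available without quotient topologies. *)
Definition collapse {K : topologicalType} (A : set K) (z : K) :
  one_point_compactification (~` A) := insub z.

Section collapse.
Context {K : topologicalType} (A : set K).

Lemma collapse_in z : A z -> collapse A z = None.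
Proof. by move=> Az; rewrite /collapse insubF//; apply/negP => /set_mem. Qed.

Lemma collapse_notin z : ~ A z -> exists2 w : (~` A : set K),
  collapse A z = Some w & set_val w = z.
Proof.
move=> /mem_set nAz; exists (exist _ z nAz) => //.
by rewrite /collapse insubT.
Qed.

Lemma collapse_eq_None z : collapse A z = None -> A z.
Proof. by move=> zN; apply: contrapT => /collapse_notin[w]; rewrite zN. Qed.

Lemma collapse_eq_Some z w : collapse A z = Some w -> set_val w = z.
Proof. by rewrite /collapse; case: insubP => // ? _ <- [<-]. Qed.

Lemma collapse_val (w : (~` A : set K)) : collapse A (set_val w) = Some w.
Proof. exact: valK. Qed.

Hypotheses (cK : compact [set: K]) (hK : hausdorff_space K) (clA : closed A).

Lemma collapse_hausdorff : hausdorff_space (one_point_compactification (~` A)).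
Proof.
apply: one_point_compactification_hausdorff.
  exact: subtype_hausdorff.
by apply: compact_open_locally_compact => //; exact: closed_openC.
Qed.

(** At points of [A], a neighborhood of infinity is the complement of a compact
    part of [~` A], whose image in [K] is closed. Outside [A], continuity is
    local since [~` A] is open. *)
Lemma collapse_continuous : continuous (collapse A).
Proof.
move=> z; have [Az|/[dup] nAz /collapse_notin[w zw wz]] := pselect (A z).
  rewrite /continuous_at (collapse_in Az) => V [C [cC _] CV].
  have cl : closed (set_val @` C).
    apply: compact_closed => //; apply: continuous_compact => //.
    by apply: continuous_subspaceT; exact: subtype_val_continuous.
  have : nbhs z (~` (set_val @` C)).
    apply: open_nbhs_nbhs; split; first exact: closed_openC.
    by move=> [c _ cz]; have : (~` A) z by rewrite -cz; exact: set_valP.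
  apply: filterS => y nCy; apply: CV => /=.
  case E : (collapse A y) => [v|]; [left|by right].
  by exists v => // Cv; apply: nCy; exists v => //; exact: collapse_eq_Some.
rewrite /continuous_at zw => V [_ [[W oW <-] Ww] WV].
have : nbhs z (W `&` ~` A).
  apply: open_nbhs_nbhs; split; first by apply: openI => //; exact: closed_openC.
  by split=> //; rewrite -wz.
apply: filterS => y [Wy /collapse_notin[v yv vy]] /=.
by rewrite yv; apply: WV => /=; rewrite vy.
Qed.

Lemma collapse_embedding (X : topologicalType) (e : X -> K) :
  topological_embedding e -> (forall x, ~ A (e x)) ->
  topological_embedding (collapse A \o e).
Proof.
move=> emb eA; have [eI eO] := emb; split.
  move=> x y /=; have [w -> wx] := collapse_notin (eA x).
  by move=> /esym/collapse_eq_Some; rewrite wx => /eI.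
move=> U; split=> [/eO[W oW <-]|[V oV <-]].
  exists (Some @` (set_val @^-1` W)).
    by apply: one_point_compactification_open_some; exists W.
  apply/seteqP; split=> [x [w Ww /esym/collapse_eq_Some wx]|x Wx].
    by rewrite /= -wx.
  have [w xw wx] := collapse_notin (eA x).
  by exists w => //=; rewrite wx.
apply: open_comp => // x _; apply: continuous_comp; last exact: collapse_continuous.
exact: topological_embedding_continuous.
Qed.

End collapse.

(** The extension is the image of [range e `|` A] under [collapse A]. Its
    complement is the image of a compact set, so it is open in a compact
    Hausdorff space; this gives local compactness, and with it the Tychonoff
    property. The map [j] is the inclusion into the collapsed space, kept in the
    conclusion because it is what determines the set [ope_mu] of the result. *)
Lemma collapse_extension (R : realType) (X K : topologicalType) (e : X -> K) (A : set K) :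
  compact [set: K] -> hausdorff_space K ->
  topological_embedding e -> dense (range e) ->
  closed A -> A !=set0 -> (forall x, ~ A (e x)) -> open (range e `|` A) ->
  exists Y : one_point_extension X, exists j : Y -> one_point_compactification (~` A),
    [/\ locally_compact [set: Y], topological_embedding j,
        forall x, j (ope_incl Y x) = collapse A (e x) & j (ope_pt Y) = None].
Proof.
move=> cK hK emb de clA [a Aa] eA oeA.
pose i := collapse A \o e.
have ci : topological_embedding i by exact: collapse_embedding.
have hZ := collapse_hausdorff cK hK clA.
pose B : set (one_point_compactification (~` A)) := collapse A @` (range e `|` A).
(* The set range e `|` A is saturated, so complements commute with the image. *)
have BE : ~` B = collapse A @` ~` (range e `|` A).
  apply/seteqP; split=> [|_ [z nz <-] [y yA yz]].
    move=> [w|] nB; last by case: nB; exists a; [right|exact: collapse_in].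
    exists (set_val w); last exact: collapse_val.
    by move=> wA; apply: nB; exists (set_val w) => //; exact: collapse_val.
  case: yA => [[x _ xy]|Ay].
    apply: nz; left; exists x => //; move: yz; rewrite -xy.
    have [w -> <-] := collapse_notin (eA x).
    by move=> /esym/collapse_eq_Some.
  by apply: nz; right; apply: collapse_eq_None; rewrite -yz collapse_in.
have oB : open B.
  rewrite -[B]setCK BE; apply: closed_openC; apply: compact_closed => //.
  apply: continuous_compact.
    by apply: continuous_subspaceT; exact: collapse_continuous.
  by apply: (@subclosed_compact _ _ [set: K]) => //; exact: open_closedC.
have Bi x : i x \in B by apply/mem_set; exists (e x) => //; left; exists x.
have BN : None \in B by apply/mem_set; exists a; [right|exact: collapse_in].
pose incl x : B := exist _ (i x) (Bi x).
pose pt : B := exist _ None BN.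
have cincl : continuous incl.
  by apply: subtype_continuous; exact: topological_embedding_continuous.
have lB : locally_compact [set: B].
  by apply: compact_open_locally_compact => //; exact: one_point_compactification_compact.
have hB : hausdorff_space B by exact: subtype_hausdorff.
have emb_incl : topological_embedding incl.
  have [iI iO] := ci; split=> [x y xy|U].
    by apply: iI; exact: (congr1 set_val xy).
  split=> [/iO[V oV <-]|[V oV <-]]; last by apply: open_comp => // x _; exact: cincl.
  by exists (set_val @^-1` V) => //; exists V.
have dincl : dense (range incl).
  move=> O [b Ob] [V oV VO].
  have [z zA zb] := set_valP b.
  have oV' : open (collapse A @^-1` V).
    by apply: open_comp => // y _; exact: collapse_continuous.
  have [|v [Vx [x _ xE]]] := de _ _ oV'.
    by exists z; rewrite /= zb; rewrite -VO in Ob.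
  by exists (incl x); split; [move: Vx; rewrite -xE -VO|exists x].
have rB : ~` range incl = [set pt].
  apply/seteqP; split=> [b nb|_ -> [x _ /(congr1 set_val)/=]].
    have [z [[x _ xz]|Az] zb] := set_valP b; apply: val_inj => /=.
      case: nb; exists x => //; apply: val_inj; rewrite /= /i /= xz; exact: zb.
    by rewrite -[RHS](collapse_in Az); exact/esym/zb.
  by move=> /collapse_eq_None /(eA x).
have tB := @locally_compact_tychonoff R B hB lB.
exists (@OnePointExtension X B (mkcts cincl) pt tB emb_incl dincl rB), set_val.
by split=> //; exact: set_val_embedding.
Qed.

(** * The fiber of the added point *)

Lemma range_stone_cech_eta_open (R : realType) (X : topologicalType) :
  hausdorff_space X -> locally_compact [set: X] ->
  open (range (@stone_cech_eta R X)).
Proof.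
move=> hX lX.
apply: locally_compact_dense_open => //; first exact: stone_cech_hausdorff.
  exact/stone_cech_eta_embedding/(locally_compact_tychonoff R).
exact: stone_cech_eta_dense.
Qed.

Lemma ope_mu_remainder (R : realType) (X : topologicalType)
    (Y : one_point_extension X) :
  ope_mu R Y `<=` ~` range (@stone_cech_eta R X).
Proof.
move=> z zp [x _ xz]; move: zp; rewrite /ope_mu /= -xz stone_cech_mapE.
move=> /(proj1 (stone_cech_eta_embedding R (ope_tychonoff Y))) xp.
have : (~` range (ope_incl Y)) (ope_pt Y) by rewrite ope_remainder.
by apply; exists x.
Qed.

Lemma ope_mu_nonempty (R : realType) (X : topologicalType)
    (Y : one_point_extension X) :
  ope_mu R Y !=set0.
Proof.
have dF : dense (range (@stone_cech_map R _ _ (ope_incl Y))).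
  move=> O O0 oO.
  have [u [Ou [x _ xu]]] := dense_range_comp (@stone_cech_eta_continuous R Y)
    (@ope_dense _ Y) (@stone_cech_eta_dense R Y) O0 oO.
  by exists u; split=> //; exists (stone_cech_eta R x) => //; rewrite stone_cech_mapE.
have [z zp] := compact_dense_surjective (@stone_cech_compact R X)
  (@stone_cech_hausdorff R Y) (@stone_cech_map_continuous R _ _ _) dF
  (stone_cech_eta R (ope_pt Y)).
by exists z.
Qed.

(** A point of the remainder of [X] cannot be sent to some [ope_incl Y x] by
    [locally_compact_lift_fiber], so if it is sent into [Y] at all, then to
    [ope_pt Y]. This expression of the fiber is visibly relatively open, since
    [Y] is open in its Stone-Cech compactification when [Y] is locally compact. *)
Lemma ope_mu_locally_compact (R : realType) (X : topologicalType)
    (Y : one_point_extension X) :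
  locally_compact [set: X] -> locally_compact [set: Y] ->
  ope_mu R Y = stone_cech_map (ope_incl Y) @^-1` range (@stone_cech_eta R Y)
    `&` ~` range (@stone_cech_eta R X).
Proof.
move=> lX lY; apply/seteqP; split=> [z zp|z [[y _ yz] nz]].
  by split; [exists (ope_pt Y)|exact: (ope_mu_remainder zp)].
rewrite /ope_mu /= -yz; congr stone_cech_eta.
suff : (~` range (ope_incl Y)) y by rewrite ope_remainder.
move=> [x _ xy]; apply: nz; exists x => //; apply/esym.
apply: (@locally_compact_lift_fiber X _ _ _ (stone_cech_map (ope_incl Y))) => //.
- exact: stone_cech_hausdorff.
- exact: stone_cech_eta_continuous.
- exact: stone_cech_map_continuous.
- exact: stone_cech_eta_dense.
- rewrite (_ : _ \o _ = stone_cech_eta R \o ope_incl Y).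
    apply: topological_embedding_comp; first exact: ope_embedding.
    exact/stone_cech_eta_embedding/ope_tychonoff.
  by apply/funext => t; exact: stone_cech_mapE.
- by rewrite -yz stone_cech_mapE xy.
Qed.

(** Let [J] extend [j] to the Stone-Cech compactification of [Y]. The maps
    [J \o F] and [collapse A] agree on [X], hence everywhere, so [F z] and the
    added point have the same image under [J] exactly when [z] is in [A]; and
    [J] glues no other point to the added point, by
    [locally_compact_lift_fiber]. *)
Lemma ope_mu_collapse (R : realType) (X : topologicalType)
    (A : set (stone_cech R X)) (Y : one_point_extension X)
    (j : Y -> one_point_compactification (~` A)) :
  closed A -> locally_compact [set: Y] -> topological_embedding j ->
  (forall x, j (ope_incl Y x) = collapse A (stone_cech_eta R x)) ->
  j (ope_pt Y) = None -> ope_mu R Y = A.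
Proof.
move=> clA lY embj jE jp.
have hZ := collapse_hausdorff (@stone_cech_compact R X) (@stone_cech_hausdorff R X) clA.
have cj := topological_embedding_continuous embj.
have [J [[cJ JE] _]] := @stone_cech_universal R Y _ (mkcts cj) hZ
  one_point_compactification_compact.
have JF z : J (stone_cech_map (ope_incl Y) z) = collapse A z.
  apply: (@dense_continuous_eq _ _ _ (J \o stone_cech_map (ope_incl Y)) (collapse A) hZ
    (@stone_cech_eta_dense R X)) => //.
  - move=> t; apply: continuous_comp; last exact: cJ.
    exact: stone_cech_map_continuous.
  - exact: collapse_continuous (@stone_cech_hausdorff R X) clA.
  by move=> _ /set_mem[x _ <-]; rewrite /= stone_cech_mapE JE; exact: jE.
apply/seteqP; split=> [z zp|z Az].
  by apply: collapse_eq_None; rewrite -JF zp JE.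
apply: (@locally_compact_lift_fiber Y _ _ _ J) => //.
- exact: stone_cech_hausdorff.
- exact: stone_cech_eta_continuous.
- exact: stone_cech_eta_dense.
- by rewrite (_ : _ \o _ = j) //; apply/funext => y; exact: JE.
- by rewrite JF JE (collapse_in Az); exact/esym/jp.
Qed.

(* Subsets of the subspace X^* are compared with subsets of beta X through the
   inclusion [set_val]. *)
Theorem theorem2p6 (R : realType) (X : topologicalType)
    (hX : hausdorff_space X) (lX : locally_compact [set: X]) :
  ope_mu_image R (fun Y : one_point_extension X => locally_compact [set: Y]) =
  [set set_val @` B | B in
     [set B : set (stone_cech_remainder R X) | clopen B] `\ set0].
Proof.
have oX := range_stone_cech_eta_open R hX lX.
apply/seteqP; split=> [_ [Y lY <-]|_ [B [[oB clB] /eqP/set0P[b Bb]] <-]].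
  have muE := ope_mu_locally_compact R lX lY.
  exists (set_val @^-1` ope_mu R Y); last first.
    apply/seteqP; split=> [_ [z zp <-] //|z zp].
    by exists (exist _ z (mem_set (ope_mu_remainder zp))).
  split; first split.
  - exists (stone_cech_map (ope_incl Y) @^-1` range (@stone_cech_eta R Y)).
      apply: open_comp => [z _|]; first exact: stone_cech_map_continuous.
      exact: (range_stone_cech_eta_open R (proj1 (ope_tychonoff Y)) lY).
    rewrite muE; apply/seteqP; split=> z //=; last by case.
    by move=> yz; split=> //; exact: (set_valP z).
  - apply: preimage_closed; first by move=> z _; exact: subtype_val_continuous.
    apply: preimage_closed; first by move=> z _; exact: stone_cech_map_continuous.
    exact/accessible_closed_set1/hausdorff_accessible/stone_cech_hausdorff.
  - have [z zp] := ope_mu_nonempty R Y.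
    move=> /= E0; have : set0 (exist _ z (mem_set (ope_mu_remainder zp))
       : stone_cech_remainder R X) by rewrite -E0.
    by [].
have clA : closed (set_val @` B : set (stone_cech R X)).
  exact: closed_subtype_image (open_closedC oX) clB.
have A0 : (set_val @` B : set (stone_cech R X)) !=set0 by exists (set_val b), b.
have nA x : ~ (set_val @` B) (stone_cech_eta R x).
  move=> [z _ zx]; have : (~` range (@stone_cech_eta R X)) (stone_cech_eta R x).
    by rewrite -zx; exact: set_valP.
  by apply; exists x.
(* B is the trace on the remainder of an open V, and adding the range of eta
   to that trace gives the union of V and the range. *)
have oA : open (range (@stone_cech_eta R X) `|` set_val @` B).
  have [V oV <-] := oB.
  rewrite (_ : _ `|` _ = range (@stone_cech_eta R X) `|` V); first exact: openU.
  by rewrite image_preimage_set_val setUIr setUv setTI.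
have emb := stone_cech_eta_embedding R (locally_compact_tychonoff R hX lX).
have [Y [j [lY embj jE jp]]] := collapse_extension R (@stone_cech_compact R X)
  (@stone_cech_hausdorff R X) emb (@stone_cech_eta_dense R X) clA A0 nA oA.
by exists Y => //; exact: (ope_mu_collapse clA lY embj jE jp).
Qed.
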